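(* The restriction of the relation $<$ to $B_3^+$ is a well-ordering of ordinal type $\omega^\omega$.
   Context: $B_3=\langle\sigma_1,\sigma_2;\ \sigma_1\sigma_2\sigma_1=\sigma_2\sigma_1\sigma_2\rangle$ is the $3$-strand braid group, and $B_3^+$ is the submonoid generated by $\sigma_1,\sigma_2$ (it has the same presentation as a monoid). The main generator of a nonempty word in $\sigma_1^{\pm1},\sigma_2^{\pm1}$ is $\sigma_m$ where $m$ is the largest index such that $\sigma_m$ or $\sigma_m^{-1}$ occurs; the word is $\sigma$-positive if its main generator $\sigma_m$ occurs but $\sigma_m^{-1}$ does not. For $x,y\in B_3$, $x<y$ means that $x^{-1}y$ has a $\sigma$-positive expression. *)

(* Defs.v *)
From HB Require Import structures.
From mathcomp Require Import all_boot finmap.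
From mathcomp Require Import boolp classical_sets.

Set Implicit Arguments.
Unset Strict Implicit.
Unset Printing Implicit Defensive.

Local Open Scope quotient_scope.
Local Open Scope classical_set_scope.
Local Open Scope group_scope.

(* Group words over X: the letter (x, true) stands for x, (x, false) for the
   inverse of x. *)
Notation gword X := (seq (X * bool)).

Section PresentedGroup.
Variables (X : choiceType) (rel : gword X -> gword X -> Prop).
Implicit Types u v w : gword X.

Inductive word_equiv : gword X -> gword X -> Prop :=
| we_refl u : word_equiv u u
| we_sym u v : word_equiv u v -> word_equiv v u
| we_trans u v w : word_equiv u v -> word_equiv v w -> word_equiv u w
| we_cat u u' v v' :
    word_equiv u u' -> word_equiv v v' -> word_equiv (u ++ v) (u' ++ v')
| we_cancel x b : word_equiv [:: (x, b); (x, ~~ b)] [::]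
| we_rel u v : rel u v -> word_equiv u v.

Definition word_equivb u v : bool := `[< word_equiv u v >].

Lemma word_equivb_refl : reflexive word_equivb.
Proof. by move=> u; apply/asboolP; exact: we_refl. Qed.

Lemma word_equivb_sym : symmetric word_equivb.
Proof. by move=> u v; apply/asboolP/asboolP; exact: we_sym. Qed.

Lemma word_equivb_trans : transitive word_equivb.
Proof.
by move=> v u w /asboolP uv /asboolP vw; apply/asboolP; exact: we_trans uv vw.
Qed.

Canonical word_equiv_rel :=
  EquivRel word_equivb word_equivb_refl word_equivb_sym word_equivb_trans.

Definition presented := {eq_quot word_equiv_rel}.
HB.instance Definition _ := Choice.on presented.

Definition word_class (w : gword X) : presented := \pi_presented w.

Lemma word_classP u v : word_class u = word_class v <-> word_equiv u v.
Proof.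
split=> [/eqmodP/asboolP //|uv].
by apply/eqmodP/asboolP.
Qed.

Lemma word_class_repr (x : presented) : word_class (repr x) = x.
Proof. exact: reprK. Qed.

Definition inv_word (w : gword X) : gword X :=
  rev [seq (l.1, ~~ l.2) | l <- w].

Lemma inv_wordK : involutive inv_word.
Proof.
move=> w; rewrite /inv_word map_rev revK -map_comp -[RHS]map_id.
by apply: eq_map => -[x b] /=; rewrite negbK.
Qed.

Lemma inv_word_cat u v : inv_word (u ++ v) = inv_word v ++ inv_word u.
Proof. by rewrite /inv_word map_cat rev_cat. Qed.

Lemma word_equiv_mulV u : word_equiv (u ++ inv_word u) [::].
Proof.
elim: u => [|[x b] u IHu]; first exact: we_refl.
rewrite -cat1s inv_word_cat -catA (catA u).
apply: (we_trans (v := [:: (x, b)] ++ ([::] ++ inv_word [:: (x, b)]))).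
  by do 2![apply: we_cat => //; try exact: we_refl].
exact: we_cancel.
Qed.

Lemma word_equiv_mulVl u : word_equiv (inv_word u ++ u) [::].
Proof. by have := word_equiv_mulV (inv_word u); rewrite inv_wordK. Qed.

Lemma word_equiv_inv u v :
  word_equiv u v -> word_equiv (inv_word u) (inv_word v).
Proof.
move=> uv; apply: (we_trans (v := inv_word u ++ (v ++ inv_word v))).
  rewrite -[X in word_equiv X _]cats0; apply: we_cat; first exact: we_refl.
  exact/we_sym/word_equiv_mulV.
rewrite catA -[X in word_equiv _ X]cat0s.
apply: we_cat; last exact: we_refl.
apply: (we_trans (v := inv_word u ++ u)); last exact: word_equiv_mulVl.
by apply: we_cat; [exact: we_refl | exact: we_sym].
Qed.

Definition pres_mul (x y : presented) : presented :=
  locked (word_class (repr x ++ repr y)).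
Definition pres_one : presented := word_class [::].
Definition pres_inv (x : presented) : presented :=
  locked (word_class (inv_word (repr x))).

Lemma pres_mulE u v :
  pres_mul (word_class u) (word_class v) = word_class (u ++ v).
Proof.
rewrite /pres_mul -lock.
by apply/word_classP; apply: we_cat; apply/word_classP; exact: word_class_repr.
Qed.

Lemma pres_invE u : pres_inv (word_class u) = word_class (inv_word u).
Proof.
rewrite /pres_inv -lock; apply/word_classP; apply: word_equiv_inv.
by apply/word_classP; exact: word_class_repr.
Qed.

Lemma pres_mulA : associative pres_mul.
Proof.
move=> x y z.
rewrite -(word_class_repr x) -(word_class_repr y) -(word_class_repr z).
by rewrite !pres_mulE catA.
Qed.

Lemma pres_mul1g : left_id pres_one pres_mul.
Proof. by move=> x; rewrite -(word_class_repr x) pres_mulE. Qed.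

Lemma pres_mulg1 : right_id pres_one pres_mul.
Proof. by move=> x; rewrite -(word_class_repr x) pres_mulE cats0. Qed.

Lemma pres_mulVg : left_inverse pres_one pres_inv pres_mul.
Proof.
move=> x; rewrite -(word_class_repr x) pres_invE pres_mulE.
exact/word_classP/word_equiv_mulVl.
Qed.

Lemma pres_mulgV : right_inverse pres_one pres_inv pres_mul.
Proof.
move=> x; rewrite -(word_class_repr x) pres_invE pres_mulE.
exact/word_classP/word_equiv_mulV.
Qed.

HB.instance Definition _ := isGroup.Build presented
  pres_mulA pres_mul1g pres_mulg1 pres_mulVg pres_mulgV.

Lemma word_classM u v : word_class (u ++ v) = word_class u * word_class v.
Proof. by rewrite -pres_mulE. Qed.

Lemma word_class1 : word_class [::] = 1.
Proof. by []. Qed.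

Lemma word_classV u : word_class (inv_word u) = (word_class u)^-1.
Proof. by rewrite -pres_invE. Qed.

End PresentedGroup.

(* The generators sigma_1, sigma_2 are indexed by 0, 1 : 'I_2. *)
Definition s1 : 'I_2 := ord0.
Definition s2 : 'I_2 := ord_max.

Variant braid3_rel : gword 'I_2 -> gword 'I_2 -> Prop :=
| Braid3_rel : braid3_rel [:: (s1, true); (s2, true); (s1, true)]
                          [:: (s2, true); (s1, true); (s2, true)].

Definition B3 : groupType := presented braid3_rel.

Definition sigma (i : 'I_2) : B3 := word_class braid3_rel [:: (i, true)].

Definition expression_of (x : B3) (w : gword 'I_2) : Prop :=
  word_class braid3_rel w = x.

Definition main_generator n (w : gword 'I_n) (m : 'I_n) : Prop :=
  (exists b, (m, b) \in w) /\ (forall k b, (k, b) \in w -> k <= m).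

Definition sigma_positive n (w : gword 'I_n) : Prop :=
  exists m, [/\ main_generator w m, (m, true) \in w & (m, false) \notin w].

Definition braid_lt (x y : B3) : Prop :=
  exists2 w, expression_of (x^-1 * y) w & sigma_positive w.

Definition is_submonoid (G : monoidType) (M : set G) : Prop :=
  M 1 /\ forall x y, M x -> M y -> M (x * y).

Definition B3plus : set B3 := smallest (@is_submonoid B3) (range sigma).

Definition B3plus_lt (x y : B3plus) : Prop := braid_lt (val x) (val y).

Definition strict_well_order (T : Type) (R : T -> T -> Prop) : Prop :=
  [/\ forall x, ~ R x x,
      forall x y z, R x y -> R y z -> R x z,
      forall x y, [\/ R x y, x = y | R y x] &
      well_founded R].

Definition order_isomorphic (T U : Type)
    (R : T -> T -> Prop) (S : U -> U -> Prop) : Prop :=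
  exists2 f : T -> U, bijective f & forall x y, R x y <-> S (f x) (f y).

(* The ordinal omega^omega, as an ordered set: by the standard description of
   ordinal exponentiation, alpha^beta is the order type of the finitely
   supported functions beta -> alpha, compared at the largest argument where
   they differ. *)
Definition omega_omega := {fsfun nat -> nat with 0%N}.

Definition omega_omega_lt (f g : omega_omega) : Prop :=
  exists n, f n < g n /\ forall m, n < m -> f m = g m.

(* Main.v *)
From HB Require Import structures.
From mathcomp Require Import all_boot all_order all_algebra finmap zify.
From mathcomp Require Import boolp classical_sets.
Require Import Defs.

(* Write a, b for the generators and D = aba, so that D swaps a and b by
   conjugation. Every element of B_3^+ is, for some m, of the form
     D^m b^(c_0) a^-1 b^(c_1) a^-1 ... a^-1 b^(c_m) a^k:
   such elements are closed under left multiplication by a and b, since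
   a b^(x+1) = D a^-1 b^x and 1 = a^-1 b^0 a. The tuples (m; c_0, ..., c_m; k),
   ordered lexicographically, form the order omega^omega. The lexicographic
   order is contained in the braid order because the set of all a^n b y with
   n > 0 and y free of b^-1 contains D y for y free of b^-1 and is stable under
   left multiplication by a and b^-1. As the first order is total, the two
   coincide once the braid order is irreflexive. For this, B_3 acts on the
   universal cover of the circle of directions of the plane so that a fixes a
   point and b moves it, and all the points past it, forward. *)

Set Implicit Arguments.
Unset Strict Implicit.
Unset Printing Implicit Defensive.

(** * The action on directions and sigma-positive words *)

Section NontrivialPositiveWords.
Import GRing.Theory Num.Theory.
Local Open Scope ring_scope.

(* [(n, p, q)] with [upper p q] encodes the direction of the vector [(p, q)]
   turned by [n] half-turns, a point of the universal cover of the circle of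
   directions; [s1] and [s2] act by the lifts of two transvections. *)
Definition upper (p q : int) := (0 < q) || (q == 0) && (0 < p).

Definition lift_letter (l : 'I_2 * bool) (x : int * int * int) :=
  let: (n, p, q) := x in
  if l.1 == s1 then (n, if l.2 then p - q else p + q, q)
  else let r := if l.2 then q + p else q - p in
    if upper p r then (n, p, r)
    else (if l.2 then n + 1 else n - 1, - p, - r).

Definition lift_word (w : gword 'I_2) x := foldr lift_letter x w.

Definition upper_point (x : int * int * int) := upper x.1.2 x.2.

Lemma upper_point_letter l x : upper_point x -> upper_point (lift_letter l x).
Proof.
case: x l => -[n p] q [i b]; rewrite /upper_point /lift_letter /upper /=.
case: ifP => _ /=; case: b => /=; try case: ifPn => /=; lia.
Qed.

Lemma upper_point_word w x : upper_point x -> upper_point (lift_word w x).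
Proof. by elim: w => //= l w IHw /IHw; exact: upper_point_letter. Qed.

Lemma lift_word_equiv u v : word_equiv braid3_rel u v ->
  forall x, upper_point x -> lift_word u x = lift_word v x.
Proof.
elim=> {u v}.
- by [].
- by move=> u v _ IH x /IH.
- by move=> u v w _ IHu _ IHv x hx; rewrite IHu ?IHv.
- move=> u u' v v' _ IHu _ IHv x hx.
  rewrite /lift_word !foldr_cat -!/(lift_word _ _) IHv // IHu //.
  exact: upper_point_word.
- move=> -[[|[|//]] ilt] b [[n p] q]; rewrite /upper_point /lift_word /= => h.
    by rewrite /lift_letter /=; congr (_, _, _); case: b => /=; lia.
  case: b; do 2!(rewrite /lift_letter /=; case: ifPn); rewrite /upper /= in h *;
  move=> ? ?; first [congr (_, _, _); lia | exfalso; lia].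
- move=> u v [] [[n p] q]; rewrite /upper_point /lift_word /= => h.
  do !(rewrite /lift_letter /=; case: ifPn); rewrite /upper /= in h *;
  move=> *; rewrite /lift_letter /=; first [congr (_, _, _); lia | exfalso; lia].
Qed.

(** Strictly beyond [(0, 1, 0)] in the cover: the points with half-turn count [n] fill the angles
    from [n * pi] (included) to [(n + 1) * pi] (excluded). *)
Definition past_origin (x : int * int * int) :=
  (0 < x.1.1) || (x.1.1 == 0) && (0 < x.2).

Lemma past_origin_letter l x : l != (s2, false) ->
  upper_point x -> past_origin x -> past_origin (lift_letter l x).
Proof.
case: x l => -[n p] q [i b].
rewrite xpair_eqE /upper_point /past_origin /lift_letter /upper /=.
case: ifPn => //= /negPf i1; have ->: i == s2.
  by case: i i1 => -[|[|]].
by case: b => //= _; case: ifPn => /= ?; lia.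
Qed.

(** [s1] and its inverse fix [(0, 1, 0)]; the rightmost [s2] acts first and moves it forward, and no
    later letter brings it back. *)
Lemma past_origin_word w : (s2, false) \notin w ->
  past_origin (lift_word w (0, 1, 0)) = ((s2, true) \in w).
Proof.
have fix1 v : (s2, false) \notin v -> (s2, true) \notin v ->
  lift_word v (0, 1, 0) = (0, 1, 0).
  elim: v => //= -[i b] v IHv; rewrite !inE !negb_or => /andP[h h1] /andP[h' h2].
  rewrite IHv //; case: i h h' => -[|[|//]] //= ip; last by case: b.
  by move=> _ _; rewrite /lift_letter /=; case: b.
have [|] := boolP ((s2, true) \in w); last first.
  by move=> h1 h2; rewrite fix1.
elim: w => //= l w IHw; rewrite !inE negb_or eq_sym => h /andP[lN wN].
have [h2|h2] := boolP ((s2, true) \in w).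
  apply: past_origin_letter; rewrite 1?eq_sym ?IHw //.
  exact: upper_point_word.
move: h; rewrite (negPf h2) orbF eq_sym => /eqP <-.
by rewrite fix1.
Qed.

(** The abelianization of [B3]. It handles the words in [s1] alone, which fix the base point of the
    action. *)
Definition exponent_sum (w : gword 'I_2) : int :=
  \sum_(l <- w) (if l.2 then 1 else -1).

Lemma exponent_sum_equiv u v : word_equiv braid3_rel u v ->
  exponent_sum u = exponent_sum v.
Proof.
elim=> {u v} //.
- by move=> u v w _ -> _ ->.
- by move=> u u' v v' _ hu _ hv; rewrite /exponent_sum !big_cat /=
    -!/(exponent_sum _) hu hv.
- by move=> i []; rewrite /exponent_sum !big_cons big_nil /=; lia.
- by move=> u v []; rewrite /exponent_sum !big_cons.
Qed.

Lemma sigma_positive_neq1 (w : gword 'I_2) :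
  sigma_positive w -> ~ word_equiv braid3_rel w [::].
Proof.
case=> -[[|[|//]] mlt] [[_ wmax] wT wF] w1.
  have := exponent_sum_equiv w1; rewrite /exponent_sum big_nil => w0.
  have allT l : l \in w -> l.2.
    case: l => -[[|i] ilt] [] //= lw; last by have := wmax _ _ lw.
    by case/negP: wF; congr ((_, _) \in w): lw; apply: val_inj.
  move: w0 wT; rewrite big_seq (eq_bigr (fun=> 1)) => [|l /allT -> //].
  rewrite -big_seq big_const_seq count_predT iter_addr addr0.
  by move/eqP; rewrite mulrn_eq0 orbF => /nilP ->.
have eq2 : Ordinal mlt = s2 by apply: val_inj.
rewrite eq2 in wT wF.
have := past_origin_word wF; rewrite wT.
by rewrite (lift_word_equiv w1).
Qed.

End NontrivialPositiveWords.

(** * The braid order as a strict order *)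

Local Open Scope group_scope.

Local Notation a := (sigma s1).
Local Notation b := (sigma s2).

Lemma sigmaV i : (sigma i)^-1 = word_class braid3_rel [:: (i, false)].
Proof. by rewrite /sigma -word_classV. Qed.

Lemma braid3E : a * b * a = b * a * b.
Proof. by rewrite /sigma -!word_classM; apply/word_classP/we_rel. Qed.

Lemma conj_sigma : b ^ a^-1 = a ^ b.
Proof.
rewrite !conjgE invgK; apply: (mulgI b); apply: (mulIg a).
by rewrite mulVKg !mulgA mulgVK braid3E.
Qed.

Lemma sigma_positive_cat (u v : gword 'I_2) :
  sigma_positive u -> sigma_positive v -> sigma_positive (u ++ v).
Proof.
case=> m [[[c mc] umax] mT mF] [m' [[[c' mc'] vmax] mT' mF']].
have [le_mm'|lt_m'm] := leqP m m'; [exists m' | exists m]; split.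
- split=> [|k d]; first by exists true; rewrite mem_cat mT' orbT.
  by rewrite mem_cat => /orP[/umax km|/vmax //]; exact: leq_trans km le_mm'.
- by rewrite mem_cat mT' orbT.
- rewrite mem_cat negb_or mF' andbT.
  apply: contra mF => /[dup] /umax m'm; suff -> : m' = m by [].
  by apply: val_inj => /=; lia.
- split=> [|k d]; first by exists true; rewrite mem_cat mT.
  by rewrite mem_cat => /orP[/umax //|/vmax km]; lia.
- by rewrite mem_cat mT.
rewrite mem_cat negb_or mF /=; apply/negP => /vmax; lia.
Qed.

Lemma braid_lt_trans x y z : braid_lt x y -> braid_lt y z -> braid_lt x z.
Proof.
move=> [u ux u0] [v vx v0]; exists (u ++ v); last exact: sigma_positive_cat.
by rewrite /expression_of word_classM ux vx mulgA mulgK.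
Qed.

Lemma braid_lt_irr x : ~ braid_lt x x.
Proof.
case=> w; rewrite /expression_of mulVg => w1 /sigma_positive_neq1; apply.
exact/word_classP.
Qed.

(** * Elements without [b^-1] and criteria for the order *)

Definition no_s2V (x : B3) : Prop :=
  exists2 w, expression_of x w & (s2, false) \notin w.

Lemma no_s2V1 : no_s2V 1.
Proof. by exists [::]. Qed.

Lemma no_s2VM x y : no_s2V x -> no_s2V y -> no_s2V (x * y).
Proof.
move=> [u ux u0] [v vx v0]; exists (u ++ v); last by rewrite mem_cat negb_or u0.
by rewrite /expression_of word_classM ux vx.
Qed.

Lemma no_s2VX x n : no_s2V x -> no_s2V (x ^+ n).
Proof.
move=> x0; elim: n => [|n IHn]; first exact: no_s2V1.
by rewrite expgS; exact: no_s2VM.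
Qed.

Lemma no_s2V_sigma i : no_s2V (sigma i).
Proof. by exists [:: (i, true)]; rewrite ?inE ?xpair_eqE ?andbF. Qed.

Lemma no_s2V_s1V : no_s2V a^-1.
Proof. by exists [:: (s1, false)]; rewrite ?inE // /expression_of sigmaV. Qed.

Local Hint Resolve no_s2V1 no_s2VM no_s2VX no_s2V_sigma no_s2V_s1V : core.

Lemma braid_ltE x y : braid_lt x y <-> braid_lt 1 (x^-1 * y).
Proof. by rewrite /braid_lt invg1 mul1g. Qed.

Lemma braid_lt_s2 y z : no_s2V y -> no_s2V z -> braid_lt 1 (y * b * z).
Proof.
move=> [u ux u0] [v vx v0]; exists (u ++ [:: (s2, true)] ++ v).
  by rewrite /expression_of !word_classM ux vx invg1 mul1g mulgA.
exists s2; rewrite !mem_cat !inE eqxx orbT; split=> //.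
- split=> [|k d _]; last by case: k => k /=; rewrite ltnS.
  by exists true; rewrite !mem_cat !inE eqxx orbT.
- by rewrite (negPf u0) (negPf v0).
Qed.

Lemma braid_lt_s1 n : braid_lt 1 (a ^+ n.+1).
Proof.
exists (nseq n.+1 (s1, true)).
  rewrite /expression_of invg1 mul1g; elim: n => // n IHn.
  by rewrite expgS -IHn -word_classM.
have mem k d : (k, d) \in nseq n.+1 (s1, true) -> k = s1 /\ d = true.
  by move=> /nseqP[[-> ->]].
have s1w : (s1, true) \in nseq n.+1 (s1, true) by rewrite inE eqxx.
exists s1; split=> //; last by apply/negP => /mem[].
by split=> [|k d /mem[-> _] //]; exists true.
Qed.

(* The elements [a^n b y] with [n > 0] and [y] without [b^-1]. This set is
   stable under left multiplication by [b^-1], as [b^-1 a^n b = a b^n a^-1]. *)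
Definition s1s2_head (x : B3) : Prop :=
  exists n y, no_s2V y /\ x = a ^+ n.+1 * b * y.

Lemma s1s2_head_s1 x : s1s2_head x -> s1s2_head (a * x).
Proof.
by move=> [n [z [z0 ->]]]; exists n.+1, z; rewrite [in RHS]expgS !mulgA.
Qed.

Lemma s1s2_head_s2V x : s1s2_head x -> s1s2_head (b^-1 * x).
Proof.
move=> [n [z [z0 ->]]]; exists 0, (b ^+ n * a^-1 * z); split; first by auto.
rewrite expg1 !mulgA -(mulgA b^-1) -conjgE conjXg -conj_sigma -conjXg.
by rewrite conjgE invgK expgS !mulgA.
Qed.

Lemma braid_lt_s1s2_head n x : s1s2_head x -> braid_lt 1 (a ^- n * x).
Proof.
move=> [m [z [z0 ->]]]; rewrite !mulgA; apply: braid_lt_s2 => //.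
by rewrite -expVgn; auto.
Qed.

(** Being a stability condition, it passes to products; [b] and [a^-1] satisfy it. *)
Definition below_s1s2 (x : B3) : Prop :=
  forall z, s1s2_head z -> s1s2_head (x^-1 * z).

Lemma below_s1s2_1 : below_s1s2 1.
Proof. by move=> z; rewrite invg1 mul1g. Qed.

Lemma below_s1s2M x y : below_s1s2 x -> below_s1s2 y -> below_s1s2 (x * y).
Proof. by move=> hx hy z /hx/hy; rewrite mulgA invgM. Qed.

Lemma below_s1s2_s2X n : below_s1s2 (b ^+ n).
Proof.
elim: n => [|n IHn]; first exact: below_s1s2_1.
by rewrite expgS; apply: below_s1s2M => // z; exact: s1s2_head_s2V.
Qed.

Lemma below_s1s2_s1V : below_s1s2 a^-1.
Proof. by move=> z; rewrite invgK; exact: s1s2_head_s1. Qed.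

Local Hint Resolve below_s1s2_1 below_s1s2M below_s1s2_s2X below_s1s2_s1V : core.

(** The quotient is [a^-n (x^-1 y)]: [x^-1] keeps [y] in [s1s2_head], and [a^-n] is harmless because
    the prefix before a [b] may contain [a^-1]. *)
Lemma braid_lt_below x n y :
  below_s1s2 x -> s1s2_head y -> braid_lt (x * a ^+ n) y.
Proof.
move=> x0 y0; apply/braid_ltE; rewrite invgM -mulgA.
by apply: braid_lt_s1s2_head; exact: x0.
Qed.

(** * Comparison of alternating products *)

Local Notation D := (a * b * a).

(** With [c_i = f (n + 1 - i)] and [k = f 0], this is the shape of the factor after the power of
    [D]; weightier arguments of [f] stand further left. *)
Fixpoint tail_braid (f : nat -> nat) (n : nat) : B3 :=
  if n is m.+1 then b ^+ f m.+2 * a^-1 * tail_braid f m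
  else b ^+ f 1%N * a ^+ f 0.

Lemma eq_tail_braid f g n : (forall k, k <= n.+1 -> f k = g k) ->
  tail_braid f n = tail_braid g n.
Proof.
elim: n => [|n IHn] fg /=; first by rewrite !fg.
by rewrite fg // IHn // => k kn; apply: fg; lia.
Qed.

Lemma tail_braid_below f n :
  exists2 x, below_s1s2 x & tail_braid f n = x * a ^+ f 0.
Proof.
elim: n => [|n [x x0 IHn]] /=; first by exists (b ^+ f 1%N).
by exists (b ^+ f n.+2 * a^-1 * x); [auto | rewrite IHn mulgA].
Qed.

Lemma no_s2V_tail_braid f n : no_s2V (tail_braid f n).
Proof. by elim: n => [|n IHn] /=; auto. Qed.
Local Hint Resolve no_s2V_tail_braid : core.

Lemma braid_lt_mull z x y : braid_lt (z * x) (z * y) <-> braid_lt x y.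
Proof. by rewrite /braid_lt invgM -mulgA mulKg. Qed.

Lemma expg_ltn (x : B3) m n : m < n -> exists k, x ^+ n = x ^+ m * x ^+ k.+1.
Proof. by move=> mn; exists (n - m).-1; rewrite -expgnDr; congr (_ ^+ _); lia. Qed.

(** Once the common left factor is cancelled, a power of [a] decides if [n = 0], a [b] among letters
    other than [b^-1] if [n = 1], and [s1s2_head] beyond. *)
Lemma tail_braid_lt f g n m : n <= m.+1 -> f n < g n ->
  (forall k, n < k <= m.+1 -> f k = g k) ->
  braid_lt (tail_braid f m) (tail_braid g m).
Proof.
elim: m => [|m IHm] nm fgn fg /=.
  move: n nm fgn fg => [|[|//]] _ lt_fg fg.
    have [k ->] := expg_ltn a lt_fg; rewrite fg //.
    apply/braid_lt_mull/braid_ltE; rewrite mulKg; exact: braid_lt_s1.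
  have [k ->] := expg_ltn b lt_fg; rewrite -mulgA; apply/braid_lt_mull/braid_ltE.
  by rewrite expgS !mulgA -mulgA; apply: braid_lt_s2; rewrite -?expVgn; auto.
move: nm; rewrite leq_eqVlt => /orP[/eqP nE|nm]; last first.
  rewrite fg ?leqnn ?andbT //; apply/braid_lt_mull/IHm => // k /andP[nk km].
  by apply: fg; rewrite nk leqW.
rewrite {}nE in fgn fg *; have [x x0 ->] := tail_braid_below f m.
have [k ->] := expg_ltn b fgn; rewrite -!mulgA; apply/braid_lt_mull.
(* Multiplying by [a] removes the [a^-1] before [x] and makes the right side start with [a b]. *)
apply/(braid_lt_mull a); rewrite mulVKg; apply: braid_lt_below => //.
exists 0, (b ^+ k * a^-1 * tail_braid g m); split; first by auto.
by rewrite expgS !mulgA.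
Qed.

(** * The Garside element and the positive monoid *)

Lemma sigma_garside i : sigma i * D = D * sigma (rev_ord i).
Proof.
case: i => -[|[|//]] ilt.
  have [-> ->] : Ordinal ilt = s1 /\ rev_ord s1 = s2 by split; exact: val_inj.
  by rewrite {1}braid3E !mulgA.
have [-> ->] : Ordinal ilt = s2 /\ rev_ord s2 = s1 by split; exact: val_inj.
by rewrite {2}braid3E !mulgA.
Qed.

Lemma garside_s2 : D * b = a * D.
Proof. by rewrite (sigma_garside s1); congr (_ * sigma _); exact: val_inj. Qed.

Lemma sigma_garsideX i n :
  sigma i * D ^+ n = D ^+ n * sigma (iter n (@rev_ord 2) i).
Proof.
elim: n => [|n IHn]; first by rewrite mulg1 mul1g.
by rewrite expgSr mulgA IHn -mulgA sigma_garside mulgA.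
Qed.

Lemma garsideX_sigma i n :
  D ^+ n * sigma i = sigma (iter n (@rev_ord 2) i) * D ^+ n.
Proof.
rewrite sigma_garsideX; congr (_ * sigma _).
by elim: n => // n IHn; rewrite iterSr [iter n.+1 _ _]/= rev_ordK.
Qed.

Lemma B3plus1 : B3plus 1.
Proof. by move=> M [[]]. Qed.

Lemma B3plusM x y : B3plus x -> B3plus y -> B3plus (x * y).
Proof.
by move=> hx hy M MP; case: (MP) => -[_ +] _; apply; [exact: hx | exact: hy].
Qed.

Lemma B3plus_sigma i : B3plus (sigma i).
Proof. by move=> M [_]; apply; exists i. Qed.

(** The elements whose left multiplication preserves [P] form a submonoid containing the
    generators. *)
Lemma B3plus_ind (P : B3 -> Prop) : P 1 ->
  (forall i x, P x -> P (sigma i * x)) -> forall x, B3plus x -> P x.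
Proof.
move=> P1 Psig x xpos; rewrite -[x]mulg1.
apply: (smallest_sub (X := [set z | forall y, P y -> P (z * y)])%classic) xpos _ P1.
  split=> /= [y|y z Py Pz t Pt]; first by rewrite mul1g.
  by rewrite -mulgA; apply/Py/Pz.
by move=> _ [i _ <-] y; exact: Psig.
Qed.

Lemma B3plusX x n : B3plus x -> B3plus (x ^+ n).
Proof.
move=> xP; elim: n => [|n IHn]; first exact: B3plus1.
by rewrite expgS; exact: B3plusM.
Qed.

Local Hint Resolve B3plus1 B3plusM B3plus_sigma B3plusX : core.

Lemma garsideX_B3plus n x : B3plus x ->
  exists2 y, B3plus y & D ^+ n * x = y * D ^+ n.
Proof.
move=> xP; elim/B3plus_ind: x / xP => [|i x [y yP xy]].
  by exists 1; rewrite ?mulg1 ?mul1g.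
exists (sigma (iter n (@rev_ord 2) i) * y); first by auto.
by rewrite mulgA garsideX_sigma -mulgA xy mulgA.
Qed.

(** One [D] absorbs one [a^-1]: [D b^c a^-1 = a^c D a^-1 = a^c a b]. *)
Lemma garsideX_factor n c x : B3plus (D ^+ n * x) ->
  B3plus (D ^+ n.+1 * (b ^+ c * a^-1 * x)).
Proof.
move=> xP; have Dbc : D * b ^+ c = a ^+ c * D.
  elim: c => [|c IHc]; first by rewrite mulg1 mul1g.
  by rewrite expgSr mulgA IHc expgSr -mulgA garside_s2 mulgA.
have [] := @garsideX_B3plus n (a ^+ c * a * b); first by auto.
move=> y yP Dy.
have key : D * (b ^+ c * a^-1 * x) = a ^+ c * a * b * x.
  by rewrite mulgA (mulgA D) Dbc !mulgA mulgK.
by rewrite expgSr -(mulgA (D ^+ n)) key mulgA Dy -mulgA; auto.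
Qed.

Lemma B3plus_tail_braid f n : B3plus (D ^+ n * tail_braid f n).
Proof.
elim: n => [|n IHn] /=; first by rewrite mul1g; auto.
exact: garsideX_factor.
Qed.

(** * The order on omega^omega *)

Implicit Types f g : omega_omega.
Definition deg (f : omega_omega) : nat := \max_(i <- finsupp f) i.

Lemma deg_lt f k : deg f < k -> f k = 0%N.
Proof.
move=> lt_k; apply/eqP; apply: contraTT lt_k => fk; rewrite -leqNgt.
by apply: leq_bigmax_seq; rewrite ?mem_finsupp.
Qed.

Lemma deg_ge f k : f k != 0%N -> k <= deg f.
Proof. by apply: contraNT; rewrite -ltnNge => /deg_lt ->. Qed.

(** Degree 0 is excluded because the maximum over an empty support is also 0. *)
Lemma deg_neq0 f : 0 < deg f -> f (deg f) != 0%N.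
Proof.
suff: (deg f == 0%N) || (f (deg f) != 0%N) by rewrite lt0n; case: eqP.
rewrite /deg big_seq; elim/big_ind: _ => // [i j|i]; last first.
  by rewrite mem_finsupp orbC => ->.
by rewrite /maxn; case: ifP.
Qed.

Lemma omega_omega_lt_trichotomy f g :
  [\/ omega_omega_lt f g, f = g | omega_omega_lt g f].
Proof.
have [fg|] := pselect (exists k, f k != g k); last first.
  move=> nfg; apply: Or32; apply/fsfunP => k.
  by apply/eqP/negP => /negP fk; apply: nfg; exists k.
have ub k : f k != g k -> k <= maxn (deg f) (deg g).
  move=> fgk; rewrite leq_max; apply/orP.
  have [fk|/deg_ge] := eqVneq (f k) 0%N; last by left.
  by right; apply: deg_ge; move: fgk; rewrite fk eq_sym.
have [k fgk kmax] := ex_maxnP fg ub.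
have eqk j : k < j -> f j = g j.
  by move=> kj; apply/eqP; apply: contraTT kj => /kmax; rewrite -leqNgt.
have [lt|lt|eq] := ltngtP (f k) (g k); last by rewrite eq eqxx in fgk.
  by apply: Or31; exists k.
by apply: Or33; exists k; split=> // j /eqk.
Qed.

Definition lex_lt (d : nat) (u v : nat -> nat) : Prop :=
  exists n, [/\ n < d, u n < v n & forall m, n < m < d -> u m = v m].

(** Induction on [d], then on the value at the top index, then along [lex_lt d]: a predecessor
    lowers the top value, or keeps it and descends in [lex_lt d]. *)
Lemma lex_lt_wf d : well_founded (lex_lt d).
Proof.
elim: d => [|d IHd] f; first by constructor=> g [n []].
move: {2}(f d) (erefl (f d)) => v; elim/ltn_ind: v f => v IHv f.
elim: f / (IHd f) => f _ IHf fv; constructor=> g [n [nd lt_gf eq_gf]].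
move: nd; rewrite ltnS leq_eqVlt => /orP[/eqP nd|nd].
  by apply: (IHv (g d)) => //; rewrite -fv -nd.
apply: IHf; last by rewrite eq_gf ?nd ?leqnn.
exists n; split=> // m /andP[nm md]; apply: eq_gf.
by rewrite nm ltnW.
Qed.

Lemma omega_omega_lt_wf : well_founded omega_omega_lt.
Proof.
move=> f; have : forall k, deg f < k -> f k = 0%N by move=> k /deg_lt.
(* The bound [d] stays fixed during the descent: predecessors of [f] also vanish beyond [d]. *)
move: (deg f) => d; move: {2 3}(f : nat -> nat) (erefl (f : nat -> nat)) => h.
elim: h / (lex_lt_wf d.+1 h) f => h _ IHh f fh f0.
constructor=> g [n [lt_gf eq_gf]].
have nd : n < d.+1 by rewrite ltnNge; apply/negP => /f0; rewrite -fh; lia.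
apply: (IHh g) => //.
  by exists n; rewrite -fh; split=> // m /andP[/eq_gf].
by move=> k dk; rewrite eq_gf ?fh ?f0 //; lia.
Qed.

(** * The normal form: positivity and monotonicity *)

(* [c_0] is one less than the top coefficient of [f] when [m > 0]. Up to moving
   every [D] to the left, this is the alternating normal form
   [... s1^(e_3) s2^(e_2) s1^(e_1)]. *)
Definition normal_braid (f : omega_omega) : B3 :=
  let m := (deg f).-1 in D ^+ m * (b ^- (0 < m) * tail_braid f m).

Lemma normal_braid_small f : deg f <= 1 ->
  normal_braid f = b ^+ f 1%N * a ^+ f 0.
Proof.
move=> f1; rewrite /normal_braid; have -> /= : (deg f).-1 = 0%N by lia.
by rewrite invg1 !mul1g.
Qed.

Lemma normal_braid_large f m : deg f = m.+2 -> exists c,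
  f m.+2 = c.+1 /\
  normal_braid f = D ^+ m.+1 * (b ^+ c * a^-1 * tail_braid f m).
Proof.
move=> fm; have := @deg_neq0 f; rewrite fm => /(_ isT).
case E: (f m.+2) => [//|c] _; exists c; split=> //.
by rewrite /normal_braid fm /= E expg1 (expgS b) -!mulgA mulKg.
Qed.

Lemma B3plus_normal_braid f : B3plus (normal_braid f).
Proof.
have [f1|f1] := leqP (deg f) 1; first by rewrite normal_braid_small; auto.
have [m fm] : exists m, deg f = m.+2 by exists (deg f).-2; lia.
have [c [_ ->]] := normal_braid_large fm.
by apply: garsideX_factor; exact: B3plus_tail_braid.
Qed.

Lemma normal_braid_below f : exists2 x, below_s1s2 x &
  normal_braid f = D ^+ (deg f).-1 * (x * a ^+ f 0).
Proof.
have [f1|f1] := leqP (deg f) 1.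
  exists (b ^+ f 1%N) => //; rewrite normal_braid_small //.
  have -> : (deg f).-1 = 0%N by lia.
  by rewrite mul1g.
have [m fm] : exists m, deg f = m.+2 by exists (deg f).-2; lia.
have [c [_ ->]] := normal_braid_large fm; rewrite fm /=.
have [x x0 ->] := tail_braid_below f m.
by exists (b ^+ c * a^-1 * x); [auto | rewrite !mulgA].
Qed.

Lemma normal_braid_lt f g :
  omega_omega_lt f g -> braid_lt (normal_braid f) (normal_braid g).
Proof.
move=> [n [lt_fg eq_fg]].
have ng : n <= deg g by apply: deg_ge; lia.
have le_fg : deg f <= deg g.
  have [//|gf] := leqP (deg f) (deg g).
  have := @deg_neq0 f; rewrite eq_fg ?(deg_lt gf) //; last by lia.
  by move=> /(_ _)/eqP; case; lia.
have [eq_deg|neq_deg] := eqVneq (deg f).-1 (deg g).-1.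
  rewrite /normal_braid eq_deg; apply/braid_lt_mull/braid_lt_mull.
  by apply: (tail_braid_lt _ lt_fg) => [|k /andP[/eq_fg]]; lia.
have [x x0 ->] := normal_braid_below f.
have [m gm] : exists m, deg g = m.+2 by exists (deg g).-2; lia.
have [c [_ ->]] := normal_braid_large gm.
have [k ->] := @expg_ltn D (deg f).-1 m.+1 ltac:(lia).
rewrite -(mulgA (D ^+ _)); apply/braid_lt_mull; apply: braid_lt_below => //.
(* A surplus [D = a b a] on the larger side supplies the leading [a b]. *)
exists 0, (a * D ^+ k * (b ^+ c * a^-1 * tail_braid g m)); split; last first.
  by rewrite expgS !mulgA.
by auto 10.
Qed.

(** * Surjectivity onto the positive braids *)

(** Exponents are listed here from left to right, with [x] as [c_0], to suit left multiplication by
    generators. *)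
Definition block (x : nat) (c : seq nat) (k : nat) : B3 :=
  b ^+ x * \prod_(y <- c) (a^-1 * b ^+ y) * a ^+ k.

Definition block_braid (x : nat) (c : seq nat) (k : nat) : B3 :=
  D ^+ size c * block x c k.

Lemma block_cons x y c k : block x (y :: c) k = b ^+ x * a^-1 * block y c k.
Proof. by rewrite /block big_cons !mulgA. Qed.

(** Padding by [1 = a^-1 b^0 a] lengthens the list without changing the braid. *)
Lemma block_rcons0 x c k : block x (rcons c 0%N) k.+1 = block x c k.
Proof.
rewrite /block big_rcons /= mulg1 [a ^+ k.+1]expgS !mulgA.
by rewrite mulgVK.
Qed.

Lemma tail_braid_block x c k :
  tail_braid (nth 0%N (k :: rev (x :: c))) (size c) = block x c k.
Proof.
elim: c x => [|y c IHc] x; first by rewrite /block big_nil mulg1.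
rewrite block_cons -IHc /= rev_cons nth_rcons size_rev /= ltnn eqxx.
congr (_ * _); apply: eq_tail_braid => -[//|i]; rewrite ltnS => ic /=.
by rewrite nth_rcons size_rev /= ltnS ic.
Qed.

Definition seq_omega_omega (s : seq nat) : omega_omega :=
  [fsfun i in seq_fset tt (iota 0 (size s)) => nth 0%N s i].

Lemma seq_omega_omegaE s i : seq_omega_omega s i = nth 0%N s i.
Proof.
rewrite fsfunE seq_fsetE mem_iota /= add0n.
by case: ltnP => // /(nth_default 0%N) ->.
Qed.

Lemma block_braid_normal x c k : exists f, normal_braid f = block_braid x c k.
Proof.
pose f x' := seq_omega_omega (k :: rev (x' :: c)).
have fE x' i : f x' i = nth 0%N (k :: rev (x' :: c)) i by exact: seq_omega_omegaE.
have deg_f x' : deg (f x') <= (size c).+1.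
  rewrite leqNgt; apply/negP => lt_deg; have /negP := @deg_neq0 (f x') ltac:(lia).
  by apply; rewrite fE nth_default //= size_rev.
case: c @f fE deg_f => [|y c] f fE deg_f.
  exists (f x); rewrite normal_braid_small // !fE.
  by rewrite /block_braid /block big_nil /= mul1g mulg1.
(* The successor offsets the lowered top exponent in [normal_braid], and makes the top coefficient
   nonzero even for [x = 0]. *)
exists (f x.+1).
have top : f x.+1 (size c).+2 = x.+1.
  by rewrite fE /= rev_cons nth_rcons size_rev ltnn eqxx.
have fdeg : deg (f x.+1) = (size c).+2.
  by apply/eqP; rewrite eqn_leq deg_f deg_ge // top.
have [c' [E ->]] := normal_braid_large fdeg.
have -> : c' = x by move: E; rewrite top => -[].
rewrite /block_braid block_cons -tail_braid_block; congr (_ * (_ * _)).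
apply: eq_tail_braid => i ic; rewrite fE; case: i ic => //= i ic.
by rewrite [in LHS]rev_cons nth_rcons size_rev /= ic.
Qed.

Lemma normal_braid_surj z : B3plus z -> exists f, normal_braid f = z.
Proof.
move=> zP; suff [x [c [k ->]]] : exists x c k, z = block_braid x c k.
  exact: block_braid_normal.
elim/B3plus_ind: z / zP => [|i _ [x [c [k ->]]]].
  by exists 0, [::], 0; rewrite /block_braid /block big_nil !mulg1.
(* Crossing the power of [D] leaves a generator that is [a] or [b] according to parity. *)
rewrite /block_braid mulgA sigma_garsideX -mulgA.
case: (iter _ _ _) => -[|[|//]] ilt; last first.
  have -> : Ordinal ilt = s2 by exact: val_inj.
  by exists x.+1, c, k; rewrite /block expgS !mulgA.
have -> : Ordinal ilt = s1 by exact: val_inj.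
case: x => [|x].
  case: c => [|y c].
    by exists 0, [::], k.+1; rewrite /block big_nil /= !expg0 !(mulg1, mul1g) expgS.
  (* The new [a] cancels the first [a^-1]; a final zero keeps the length equal to the power of
     [D]. *)
  exists y, (rcons c 0%N), k.+1; rewrite block_rcons0 block_cons size_rcons.
  by rewrite mul1g mulVKg.
(* By [a b^(x+1) = D a^-1 b^x], the power of [D] and the length both grow by one. *)
exists 0, (x :: c), k; rewrite block_cons mul1g /= [in RHS]expgSr -!(mulgA (D ^+ _)).
by congr (_ * _); rewrite [RHS]mulgA mulgK /block expgS !mulgA.
Qed.

Theorem corollary4p21 :
  strict_well_order B3plus_lt /\ order_isomorphic B3plus_lt omega_omega_lt.
Proof.
have ltP f g : braid_lt (normal_braid f) (normal_braid g) <-> omega_omega_lt f g.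
  split=> [fg|]; last exact: normal_braid_lt.
  case: (omega_omega_lt_trichotomy f g) => [//|eq_fg|/normal_braid_lt gf].
    by case: (@braid_lt_irr (normal_braid f)); rewrite {2}eq_fg.
  by case: (braid_lt_irr (braid_lt_trans fg gf)).
have surj (x : B3plus) : exists f, normal_braid f = val x.
  exact/normal_braid_surj/set_mem/(valP x).
pose h x := projT1 (cid (surj x)).
have hE x : normal_braid (h x) = val x := projT2 (cid (surj x)).
have h_lt x y : B3plus_lt x y <-> omega_omega_lt (h x) (h y).
  by rewrite -ltP !hE.
have h_inj : injective h by move=> x y hxy; apply: val_inj; rewrite -!hE hxy.
split; last first.
  pose g f : B3plus := exist _ (normal_braid f) (mem_set (B3plus_normal_braid f)).
  exists h => //; exists g => [x|f]; first by apply: val_inj; rewrite /= hE.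
  have hgE := hE (g f).
  (* Both functions have the same normal braid, so a strict comparison would contradict
     irreflexivity. *)
  case: (omega_omega_lt_trichotomy (h (g f)) f) => // /normal_braid_lt;
    by rewrite hgE => /braid_lt_irr.
split.
- by move=> x /braid_lt_irr.
- by move=> x y z; exact: braid_lt_trans.
- move=> x y; case: (omega_omega_lt_trichotomy (h x) (h y)) => [|/h_inj|].
  + by move=> /h_lt; exact: Or31.
  + exact: Or32.
  + by move=> /h_lt; exact: Or33.
move=> x; move: {2}(h x) (erefl (h x)) => f.
elim: f / (omega_omega_lt_wf f) x => f _ IHf x hx.
by constructor=> y /h_lt yx; apply: (IHf (h y)); rewrite -?hx.
Qed.
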